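(* Let $(R, \mathfrak{m})$ be a $1$-dimensional Cohen--Macaulay local ring that has a canonical ideal. Let $P$ be an $\mathfrak{m}$-primary precanonical ideal of $R$. If $c \in P$ is such that $P/(c) \simeq (R/\mathfrak{m})^n$, for some $n$, then $P$ is a canonical ideal.
   Context: Let $(R,\mathfrak{m})$ be a Cohen--Macaulay local ring of dimension $d>0$ with residue field $k=R/\mathfrak{m}$. A finitely generated $R$-module $\omega$ is a canonical module of $R$ if $\operatorname{Ext}^i_R(k,\omega)=0$ for $i\neq d$ and $\operatorname{Ext}^d_R(k,\omega)\simeq k$. A canonical ideal of $R$ is an ideal of $R$ that is isomorphic, as an $R$-module, to a canonical module of $R$. An ideal $P$ of $R$ is closed if $\operatorname{Hom}_R(P,P)=R$, i.e. the natural homothety map $R\to \operatorname{Hom}_R(P,P)$ is an isomorphism. An ideal $P$ of $R$ is precanonical if it is closed and $\operatorname{Ext}^1_R(P,P)=0$.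
   Formalization: The n in P/(c) ≃ (R/m)^n is taken to be at least 1; for n = 0, i.e. P = (c), the claim fails, e.g. for P = (t^3) in the non-Gorenstein ring k[[t^3,t^4,t^5]]. *)

(* Defs.v *)
From HB Require Import structures.
From mathcomp Require Import all_boot all_algebra.
From mathcomp Require Import boolp functions.
From mathcomp Require Import freeg.

Set Implicit Arguments.
Unset Strict Implicit.
Unset Printing Implicit Defensive.

Import GRing.Theory.
Import Quotient.
Local Open Scope ring_scope.
Local Open Scope quotient_scope.

(** * Submodules and quotient modules

    A submodule is a [submodClosed]: its membership predicate is boolean, but
    by [boolp.asbool] every proposition gives one, so no decidability
    assumption is being made. *)

Section Submodules.
Context (R : comNzRingType) (V : lmodType R).
Implicit Type S : submodClosed V.

Definition submod_type S : Type := {x : V | x \in S}.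

HB.instance Definition _ S := SubChoice.on (submod_type S).
HB.instance Definition _ S := [SubChoice_isSubLmodule of submod_type S by <:].

Definition submod_val S (x : submod_type S) : V := val x.

Lemma submod_val_linear S : linear (@submod_val S).
Proof. by move=> a x y. Qed.
HB.instance Definition _ S :=
  GRing.isLinear.Build R (submod_type S) V _ (@submod_val S)
    (@submod_val_linear S).

Definition submod_of (p : V -> Prop) : {pred V} := fun x => `[< p x >].

Definition submod_pred S : {pred V} := S.

Lemma submod_pred_closed S : submod_closed (submod_pred S).
Proof. exact: submodClosedP. Qed.
HB.instance Definition _ S :=
  GRing.isSubmodClosed.Build R V (submod_pred S)
    (GRing.submod_closed_semi (submod_pred_closed S)).

Definition quotmod S : Type := {quot (submod_pred S)}.

HB.instance Definition _ S := GRing.Zmodule.on (quotmod S).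
HB.instance Definition _ S := Quotient.on (quotmod S).

Section QuotScale.
Variable S : submodClosed V.

Definition quotmod_pi (x : V) : quotmod S := \pi_({quot (submod_pred S)}) x.
Definition quotmod_scale (a : R) (x : quotmod S) : quotmod S :=
  quotmod_pi (a *: repr x).

Lemma quotmod_piP x y : quotmod_pi x = quotmod_pi y <-> x - y \in S.
Proof.
rewrite /quotmod_pi; split=> [/eqP|H]; first by rewrite -idealrBE.
by apply/eqP; rewrite -idealrBE.
Qed.

Lemma quotmod_piK (x : quotmod S) : quotmod_pi (repr x) = x.
Proof. exact: reprK. Qed.

Lemma quotmod_piD x y : quotmod_pi (x + y) = quotmod_pi x + quotmod_pi y.
Proof. exact: pi_addr. Qed.

Lemma quotmod_piZ a x : quotmod_pi (a *: x) = quotmod_scale a (quotmod_pi x).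
Proof.
apply/quotmod_piP; rewrite -scalerBr; apply: rpredZ.
by apply/quotmod_piP; rewrite quotmod_piK.
Qed.

Lemma quotmod_scaleA a b x :
  quotmod_scale a (quotmod_scale b x) = quotmod_scale (a * b) x.
Proof. by rewrite -(quotmod_piK x) -!quotmod_piZ scalerA. Qed.

Lemma quotmod_scale1 : left_id 1 quotmod_scale.
Proof. by move=> x; rewrite -(quotmod_piK x) -!quotmod_piZ scale1r. Qed.

Lemma quotmod_scaleDr : right_distributive quotmod_scale +%R.
Proof.
move=> a x y; rewrite -(quotmod_piK x) -(quotmod_piK y).
by rewrite -quotmod_piD -!quotmod_piZ scalerDr quotmod_piD.
Qed.

Lemma quotmod_scaleDl x : {morph quotmod_scale^~ x : a b / a + b}.
Proof.
by move=> a b; rewrite -(quotmod_piK x) -!quotmod_piZ scalerDl quotmod_piD.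
Qed.

HB.instance Definition _ := GRing.Zmodule_isLmodule.Build R (quotmod S)
  quotmod_scaleA quotmod_scale1 quotmod_scaleDr quotmod_scaleDl.

Lemma quotmod_pi_linear : linear quotmod_pi.
Proof. by move=> a x y; rewrite quotmod_piD quotmod_piZ. Qed.
HB.instance Definition _ :=
  GRing.isLinear.Build R V (quotmod S) _ quotmod_pi quotmod_pi_linear.

End QuotScale.

Definition cyclic_submod (v : V) := submod_of (fun x => exists a : R, x = a *: v).

Arguments cyclic_submod v : clear implicits.

Lemma cyclic_submod_closed v : submod_closed (cyclic_submod v).
Proof.
split=> [|a x y /asboolP[b ->] /asboolP[c ->]]; apply/asboolP.
  by exists 0; rewrite scale0r.
by exists (a * b + c); rewrite scalerDl scalerA.
Qed.
HB.instance Definition _ v :=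
  GRing.isSubmodClosed.Build R V (cyclic_submod v)
    (GRing.submod_closed_semi (cyclic_submod_closed v)).

End Submodules.

Section Maps.
Context (R : comNzRingType).
Implicit Types A B C U V : lmodType R.

Definition kernel A B (f : {linear A -> B}) := submod_of (fun x : A => f x = 0).

Arguments kernel {A B} f.

Lemma kernel_closed A B (f : {linear A -> B}) : submod_closed (kernel f).
Proof.
split=> [|a x y /asboolP fx /asboolP fy]; apply/asboolP; first exact: linear0.
by rewrite linearP fx fy scaler0 addr0.
Qed.
HB.instance Definition _ A B (f : {linear A -> B}) :=
  GRing.isSubmodClosed.Build R A (kernel f)
    (GRing.submod_closed_semi (kernel_closed f)).

(* the preimage of [im f] in [ker g]; this is [im f] itself when [g \o f = 0] *)
Definition image_in_kernel A B C (f : {linear A -> B}) (g : {linear B -> C}) :=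
  submod_of (fun y : submod_type (kernel g) => exists x : A, f x = val y).

Arguments image_in_kernel {A B C} f g.

Lemma image_in_kernel_closed A B C (f : {linear A -> B}) (g : {linear B -> C}) :
  submod_closed (image_in_kernel f g).
Proof.
split=> [|a x y /asboolP[u fu] /asboolP[v fv]]; apply/asboolP.
  by exists 0; rewrite linear0.
by exists (a *: u + v); rewrite linearP fu fv.
Qed.
HB.instance Definition _ A B C (f : {linear A -> B}) (g : {linear B -> C}) :=
  GRing.isSubmodClosed.Build R (submod_type (kernel g)) (image_in_kernel f g)
    (GRing.submod_closed_semi (image_in_kernel_closed f g)).

Definition homology A B C (f : {linear A -> B}) (g : {linear B -> C})
    : lmodType R :=
  quotmod (image_in_kernel f g).

Definition zero_module V : Prop := forall x : V, x = 0.

Definition isomorphic U V : Prop := exists f : {linear U -> V}, bijective f.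

Definition finitely_generated V : Prop :=
  exists (n : nat) (g : 'I_n -> V),
    forall x, exists a : 'I_n -> R, x = \sum_i a i *: g i.

Definition linear_maps U V := submod_of (fun f : U -> V => linear f).

Arguments linear_maps U V : clear implicits.

Lemma linear_maps_closed U V : submod_closed (linear_maps U V).
Proof.
split=> [|a f g /asboolP lf /asboolP lg]; apply/asboolP=> b x y.
  by change (0 = b *: (0 : V) + 0); rewrite scaler0 addr0.
change (a *: f (b *: x + y) + g (b *: x + y) =
        b *: (a *: f x + g x) + (a *: f y + g y)).
by rewrite lf lg !scalerDr !scalerA (mulrC a b) addrACA.
Qed.
HB.instance Definition _ U V :=
  GRing.isSubmodClosed.Build R (U -> V) (linear_maps U V)
    (GRing.submod_closed_semi (linear_maps_closed U V)).

Definition Hom U V : lmodType R := submod_type (linear_maps U V).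

Definition Hom_fun U V (f : Hom U V) : U -> V := val f.

Lemma Hom_fun_linear U V (f : Hom U V) : linear (Hom_fun f).
Proof. by apply/asboolP; exact: (valP f). Qed.

Lemma Hom_fun0 U V (f : Hom U V) : Hom_fun f 0 = 0.
Proof.
have := Hom_fun_linear f (-1) 0 0.
by rewrite scaler0 addr0 scaleN1r addNr.
Qed.

Lemma precomp_subproof A B V (f : {linear A -> B}) (g : Hom B V) :
  (Hom_fun g \o f) \in linear_maps A V.
Proof. by apply/asboolP=> a x y /=; rewrite linearP Hom_fun_linear. Qed.

(* the map Hom(f, V) *)
Definition precomp A B V (f : {linear A -> B}) (g : Hom B V) : Hom A V :=
  exist (fun h : A -> V => h \in linear_maps A V) (Hom_fun g \o f) (precomp_subproof f g).

Lemma precomp_linear A B V (f : {linear A -> B}) : linear (@precomp A B V f).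
Proof. by move=> a g h; apply: val_inj. Qed.
HB.instance Definition _ A B V (f : {linear A -> B}) :=
  GRing.isLinear.Build R (Hom B V) (Hom A V) _ (@precomp A B V f)
    (@precomp_linear A B V f).

Lemma precomp_comp0 A B C V (f : {linear A -> B}) (g : {linear B -> C}) :
  (forall x, g (f x) = 0) -> forall h : Hom C V, precomp f (precomp g h) = 0.
Proof.
move=> gf0 h; apply: val_inj; apply/funext=> x.
transitivity (Hom_fun h (g (f x))) => //.
by rewrite gf0 Hom_fun0.
Qed.

Lemma homothety_subproof V (a : R) : (fun x : V => a *: x) \in linear_maps V V.
Proof. by apply/asboolP=> b x y; rewrite scalerDr !scalerA mulrC. Qed.

Definition homothety V (a : R) : Hom V V :=
  exist (fun f : V -> V => f \in linear_maps V V) _ (homothety_subproof V a).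

End Maps.

(** * Ext

    [Ext i M N] is computed from the standard free resolution
    ... -> F_1 -> F_0 -> M, where F_i is the free module on the underlying set
    of the i-th syzygy of M (the 0-th syzygy being M itself), so that
    Ext^i(M, N) = H^i(Hom(F_*, N)). *)

Section Ext.
Context (R : comNzRingType).
Implicit Types M N : lmodType R.

Definition free_module (K : choiceType) : lmodType R := {freeg K / R}.

Definition free_cover M (x : free_module M) : M := fglift id x.

Lemma free_cover_linear M : linear (@free_cover M).
Proof.
have addB x y : free_cover (x - y) = free_cover x - free_cover y :> M.
  exact: lift_is_additive.
have add0 : free_cover 0 = 0 :> M by rewrite -(subrr 0) addB subrr.
have addD x y : free_cover (x + y) = free_cover x + free_cover y :> M.
  by rewrite -[y in LHS]opprK addB -(sub0r y) addB add0 sub0r opprK.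
have addS (s : seq M) (c : M -> R) :
    free_cover (\sum_(z <- s) << c z *g z >>) = \sum_(z <- s) c z *: z :> M.
  elim: s => [|z s IH]; first by rewrite !big_nil.
  by rewrite !big_cons addD IH /free_cover liftU.
move=> a y x; rewrite addD; congr (_ + _).
have -> : free_cover y = \sum_(z <- dom y) coeff z y *: z :> M.
  by rewrite -{1}[y]freeg_sumE addS.
have -> : free_cover (a *: y) = \sum_(z <- dom y) (a * coeff z y) *: z :> M.
  exact: addS.
rewrite scaler_sumr; by apply: eq_bigr => z _; rewrite scalerA.
Qed.
HB.instance Definition _ M :=
  GRing.isLinear.Build R (free_module M) M _ (@free_cover M)
    (@free_cover_linear M).

Definition syzygy M : lmodType R := submod_type (kernel (@free_cover M)).

Definition resolution M (i : nat) : lmodType R := free_module (iter i syzygy M).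

Definition presentation M : {linear free_module (syzygy M) -> free_module M} :=
  @submod_val R _ (kernel (@free_cover M)) \o @free_cover (syzygy M).

Definition differential M (i : nat)
    : {linear resolution M i.+1 -> resolution M i} :=
  presentation (iter i syzygy M).

Definition codifferential M N (i : nat)
    : {linear Hom (resolution M i) N -> Hom (resolution M i.+1) N} :=
  precomp (V := N) (differential M i).

Definition Ext (i : nat) M N : lmodType R :=
  match i with
  | 0 => homology (\0 : {linear Hom (resolution M 0) N -> _})
                  (codifferential M N 0)
  | j.+1 => homology (codifferential M N j) (codifferential M N j.+1)
  end.

Lemma free_cover_surj M (x : M) : exists y, free_cover y = x.
Proof. by exists << x >>; rewrite /free_cover liftU scale1r. Qed.

Lemma presentation_exact M (x : free_module M) :
  free_cover x = 0 <-> exists y, presentation M y = x.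
Proof.
split=> [x0|[y <-]]; last by apply/asboolP; exact: (valP (free_cover y)).
have xK : x \in kernel (@free_cover M) by apply/asboolP.
have [y yx] := free_cover_surj (exist _ x xK : syzygy M).
by exists y; rewrite /= yx.
Qed.

Lemma presentation_eq0 M (x : free_module (syzygy M)) :
  presentation M x = 0 <-> free_cover x = 0.
Proof. by split=> [x0|/= ->]; [exact: val_inj | exact: linear0]. Qed.

Lemma resolution_exact0 M (x : resolution M 0) :
  free_cover x = 0 <-> exists y, differential M 0 y = x.
Proof. exact: presentation_exact. Qed.

Lemma resolution_exactS M i (x : resolution M i.+1) :
  differential M i x = 0 <-> exists y, differential M i.+1 y = x.
Proof.
exact: (iff_trans (@presentation_eq0 (iter i syzygy M) x)
                  (@presentation_exact (iter i.+1 syzygy M) x)).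
Qed.

Lemma differential_comp0 M i x : differential M i (differential M i.+1 x) = 0.
Proof. by apply/(resolution_exactS (M := M)); exists x. Qed.

Lemma codifferential_comp0 M N i (f : Hom (resolution M i) N) :
  codifferential M N i.+1 (codifferential M N i f) = 0.
Proof. exact: (precomp_comp0 (@differential_comp0 M i) f). Qed.

End Ext.

(** * Local Cohen-Macaulay rings *)

Notation ideal R := (submodClosed (R : comNzRingType)^o).

Section LocalRings.
Context (R : comNzRingType).
Implicit Types I J m p : ideal R.

Definition maximal_ideal m : Prop :=
  1 \notin m /\
  forall I, {subset m <= I} -> 1 \notin I -> m =i I.

Definition local_ring m : Prop :=
  maximal_ideal m /\ forall I, maximal_ideal I -> I =i m.

Definition noetherian : Prop := forall I, finitely_generated (submod_type I).

Definition prime_ideal p : Prop := 1 \notin p /\ prime_idealr_closed p.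

(* a strict chain p_0 < ... < p_n of primes *)
Definition prime_chain (n : nat) : Prop :=
  exists p : nat -> ideal R,
    (forall i, (i <= n)%N -> prime_ideal (p i)) /\
    (forall i, (i < n)%N ->
       {subset p i <= p i.+1} /\ ~ {subset p i.+1 <= p i}).

Definition krull_dim (d : nat) : Prop := prime_chain d /\ ~ prime_chain d.+1.

Definition in_ideal_gen (s : seq R) (x : R) : Prop :=
  exists a : 'I_(size s) -> R, x = \sum_i a i * s`_i.

Definition regular_seq (s : seq R) : Prop :=
  (forall i, (i < size s)%N -> forall x,
     in_ideal_gen (take i s) (s`_i * x) -> in_ideal_gen (take i s) x) /\
  ~ in_ideal_gen s 1.

Definition regular_seq_in m (n : nat) : Prop :=
  exists s : seq R, [/\ size s = n, {subset s <= m} & regular_seq s].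

Definition depth m (n : nat) : Prop :=
  regular_seq_in m n /\ ~ regular_seq_in m n.+1.

Definition cohen_macaulay m (d : nat) : Prop :=
  [/\ noetherian, local_ring m, krull_dim d & depth m d].

Definition primary_ideal I : Prop :=
  1 \notin I /\
  forall x y, x * y \in I -> x \in I \/ exists n : nat, y ^+ n \in I.

Definition primary_to m I : Prop :=
  primary_ideal I /\ forall x, x \in m <-> exists n : nat, x ^+ n \in I.

Definition residue_field m : lmodType R := quotmod m.

Definition canonical_module m (d : nat) (W : lmodType R) : Prop :=
  [/\ finitely_generated W,
      forall i, i <> d -> zero_module (Ext i (residue_field m) W) &
      isomorphic (Ext d (residue_field m) W) (residue_field m)].

Definition canonical_ideal m (d : nat) I : Prop :=
  exists W : lmodType R,
    canonical_module m d W /\ isomorphic (submod_type I) W.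

Definition closed_ideal I : Prop := bijective (@homothety R (submod_type I)).

Definition precanonical I : Prop :=
  closed_ideal I /\ zero_module (Ext 1 (submod_type I) (submod_type I)).

End LocalRings.

(* Main.v *)
From HB Require Import structures.
From mathcomp Require Import all_boot all_algebra.
From mathcomp Require Import boolp classical_sets functions freeg.
Require Import Defs.

Set Implicit Arguments.
Unset Strict Implicit.
Unset Printing Implicit Defensive.

Import GRing.Theory.
Local Open Scope ring_scope.

(** Since P / (c) is killed by m and P is m-primary, mP lies in (c), some power of each
    element of m lies in (c), and c is a nonzerodivisor because a power of a regular element
    of m is a multiple of it. Put k = R/m and M = P / cP. The proof shows directly that P has
    the Ext groups of a canonical module, by showing that M is the injective hull of k over
    the Artinian ring R/c.

    Closedness of P makes M faithful over R/c ([quotient_faithful]). Closedness and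
    Ext^1(P, P) = 0 together say that every map P -> M is multiplication by a scalar. Applied
    to the maps p |-> lam(p) s, where lam : P -> k is a coordinate of P / (c) = k^n and s is
    in the socle of M, this forces the socle to have dimension one: the scalars found for
    two socle elements s and t lie in P, and their product computed in two ways gives a
    linear relation between s and t ([socle_dim_le1]).

    A faithful module with a simple socle over an Artinian local ring is injective. The proof
    avoids lengths: starting from I = (c), one adds one element at a time to I, and carries
    along both that I is the annihilator of its annihilator in M and that maps I/c -> M are
    multiplications ([dual_ideal_all]). Baer's argument then gives injectivity for arbitrary
    modules ([injective_extension]), as the free modules in the resolution of k have
    infinite rank.

    It remains to pass from M to P. One has Ext^0(k, P) = 0 since c is regular on P and kills
    k, and Ext^1(k, P) is the socle of M, hence is k ([Ext1_residue]). For i >= 2, Ext^i(k, P)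
    is Ext^1(S, P) with S an iterated syzygy of k; each such S is, up to a projective summand,
    a first syzygy of a module killed by c ([torsion_syzygy_step]), and for those the
    injectivity of M gives Ext^1(S, P) = 0 ([torsion_syzygy_extend]). *)

(** * Linear maps, quotients and free modules *)

Section Linear.
Context (R : comNzRingType).
Implicit Types U V A B C : lmodType R.

Lemma linear_exists U V (f : U -> V) :
  linear f -> exists g : {linear U -> V}, g =1 f.
Proof.
move=> fL; pose m := GRing.isLinear.Build R U V _ f fL.
pose g : {linear U -> V} := HB.pack f m.
by exists g.
Qed.

Lemma submod_val_inj V (S : submodClosed V) : injective (@submod_val R V S).
Proof. exact: val_inj. Qed.

Lemma Hom_of_linear U V (f : {linear U -> V}) : exists g : Hom U V, Hom_fun g =1 f.
Proof.
have fL : (f : U -> V) \in @linear_maps R U V by apply/asboolP=> a x y; exact: linearP.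
by exists (exist _ (f : U -> V) fL).
Qed.

(** Submodules as bare predicates: the ideals and graphs below are built from existential
    formulas, and their closure properties are proved as they arise. *)
Definition is_submodule V (D : V -> Prop) : Prop :=
  D 0 /\ forall a x y, D x -> D y -> D (a *: x + y).

Definition linear_on U V (D : U -> Prop) (f : U -> V) : Prop :=
  forall a x y, D x -> D y -> f (a *: x + y) = a *: f x + f y.

Lemma is_submoduleZ V (D : V -> Prop) a x : is_submodule D -> D x -> D (a *: x).
Proof. by case=> D0 DL Dx; rewrite -[_ *: _]addr0; apply: DL. Qed.

Lemma is_submoduleD V (D : V -> Prop) x y :
  is_submodule D -> D x -> D y -> D (x + y).
Proof. by case=> _ DL Dx Dy; rewrite -[x]scale1r; apply: DL. Qed.

Lemma is_submoduleB V (D : V -> Prop) x y :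
  is_submodule D -> D x -> D y -> D (x - y).
Proof. by case=> _ DL Dx Dy; rewrite addrC -scaleN1r; apply: DL. Qed.

Lemma linear_on0 U V (D : U -> Prop) (f : U -> V) :
  is_submodule D -> linear_on D f -> f 0 = 0.
Proof.
move=> [D0 _] fL; have := fL 1 0 0 D0 D0.
by rewrite !scale1r addr0 => /eqP; rewrite addrC -subr_eq subrr eq_sym => /eqP.
Qed.

Lemma linear_onZ U V (D : U -> Prop) (f : U -> V) a x :
  is_submodule D -> linear_on D f -> D x -> f (a *: x) = a *: f x.
Proof.
move=> DS fL Dx; rewrite -[a *: x in LHS]addr0 fL ?(linear_on0 DS fL) ?addr0 //.
by case: DS.
Qed.

Lemma submodClosed_is_submodule V (S : submodClosed V) :
  is_submodule (fun x => x \in S).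
Proof. by split=> [|a x y xS yS]; [exact: rpred0|apply: rpredD => //; exact: rpredZ]. Qed.

Lemma submodClosed_exists V (D : V -> Prop) :
  is_submodule D -> exists S : submodClosed V, forall x, x \in S <-> D x.
Proof.
move=> [D0 DL].
have Dcl : submod_closed (submod_of D).
  by split=> [|a x y /asboolP Dx /asboolP Dy]; apply/asboolP; [|apply: DL].
pose mx := GRing.isSubmodClosed.Build R V (submod_of D) (GRing.submod_closed_semi Dcl).
pose S : submodClosed V := HB.pack (submod_of D) mx.
by exists S => x; split=> [/asboolP|Dx] //; apply/asboolP.
Qed.

Lemma linear_factor A B C (p : {linear A -> B}) (f : {linear A -> C}) :
  (forall b, exists a, p a = b) -> (forall a, p a = 0 -> f a = 0) ->
  exists g : {linear B -> C}, forall a, g (p a) = f a.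
Proof.
move=> /choice[s sK] fK.
have fs a : f (s (p a)) = f a.
  by apply/eqP; rewrite -subr_eq0 -linearB; apply/eqP/fK; rewrite linearB /= sK subrr.
have [|g gE] := @linear_exists B C (f \o s).
  move=> a x y /=; rewrite -linearP -fs -[in RHS]fs; congr (f (s _)).
  by rewrite linearP /= !sK.
by exists g => a; rewrite gE /= fs.
Qed.

Lemma linear_lift_inj A B C (j : {linear B -> C}) (e : {linear A -> C}) :
  injective j -> (forall a, exists b, j b = e a) ->
  exists e' : {linear A -> B}, forall a, j (e' a) = e a.
Proof.
move=> jI /choice[s sE]; have [|e' e'E] := @linear_exists A B s.
  by move=> a x y; apply: jI; rewrite linearP !sE linearP.
by exists e' => a; rewrite e'E.
Qed.

Lemma scale_linear V (c : R) :
  exists f : {linear V -> V}, forall x, f x = c *: x.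
Proof. by apply: linear_exists => a x y; rewrite scalerDr !scalerA mulrC. Qed.

Lemma linear_inj0 A B (j : {linear A -> B}) :
  (forall a, j a = 0 -> a = 0) -> injective j.
Proof.
by move=> j0 x y xy; apply/eqP; rewrite -subr_eq0; apply/eqP/j0; rewrite linearB xy subrr.
Qed.

Lemma pair_linear (A B A' B' : lmodType R) (f : {linear A -> A'}) (g : {linear B -> B'}) :
  exists h : {linear (A * B)%type -> (A' * B')%type}, forall w, h w = (f w.1, g w.2).
Proof.
apply: (@linear_exists (A * B)%type (A' * B')%type) => a x y /=.
by apply/pair_equal_spec; split; rewrite /= linearP.
Qed.

Lemma inl_linear A B :
  exists h : {linear A -> (A * B)%type}, forall a, h a = (a, 0).
Proof.
apply: (@linear_exists A (A * B)%type) => a x y.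
by apply/pair_equal_spec; split; rewrite //= scaler0 addr0.
Qed.

Lemma isomorphic_sym U V : isomorphic U V -> isomorphic V U.
Proof.
case=> f [g fK gK]; have [|h hE] := @linear_exists V U g.
  by move=> a x y; apply: (can_inj fK); rewrite linearP !gK.
by exists h; exists f => x; rewrite hE.
Qed.

Lemma isomorphic_refl U : isomorphic U U.
Proof. by exists idfun; exists id. Qed.

End Linear.

Section Multiples.
Context (R : comNzRingType) (V : lmodType R) (a : R).

Definition multiples := submod_of (fun x : V => exists y, x = a *: y).

Lemma multiples_closed : submod_closed multiples.
Proof.
split=> [|b x y /asboolP[u ->] /asboolP[v ->]]; apply/asboolP.
  by exists 0; rewrite scaler0.
by exists (b *: u + v); rewrite scalerDr !scalerA mulrC.
Qed.
HB.instance Definition _ :=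
  GRing.isSubmodClosed.Build R V multiples
    (GRing.submod_closed_semi multiples_closed).

Definition quot_multiples : lmodType R := quotmod multiples.

Definition pi_multiples : {linear V -> quot_multiples} := @quotmod_pi R V multiples.

Lemma pi_multiples_eq0 x : pi_multiples x = 0 <-> exists y, x = a *: y.
Proof.
rewrite -(linear0 pi_multiples); split.
  by move/quotmod_piP; rewrite subr0 => /asboolP.
by move=> xa; apply/quotmod_piP; rewrite subr0; apply/asboolP.
Qed.

Lemma pi_multiples_surj y : exists x, pi_multiples x = y.
Proof. by exists (generic_quotient.repr y); exact: quotmod_piK. Qed.

End Multiples.

Arguments pi_multiples {R V} a.

Section FreeModules.
Context (R : comNzRingType).
Implicit Types X Y F G : lmodType R.

Lemma free_module_span (K : choiceType) (z : free_module R K) :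
  z = \sum_(k <- dom z) coeff k z *: (<< k >> : free_module R K).
Proof.
rewrite -{1}[z]freeg_sumE; apply: eq_bigr => k _.
apply/eqP/freeg_eqP => j; rewrite [RHS]coeffZ !coeffU.
by rewrite mul1r.
Qed.

Lemma free_module_lift (K : choiceType) X (t : K -> X) :
  exists s : {linear free_module R K -> X}, forall k, s << k >> = t k.
Proof.
pose s0 : free_module R K -> X := fglift t.
have [|s sE] := @linear_exists R (free_module R K) X s0; last first.
  by exists s => k; rewrite sE /s0 liftU scale1r.
have addB : {morph s0 : x y / x - y} by exact: lift_is_additive.
have s00 : s0 0 = 0 by rewrite -(subrr 0) addB subrr.
have addD : {morph s0 : x y / x + y}.
  by move=> x y; rewrite -[y in LHS]opprK addB -(sub0r y) addB s00 sub0r opprK.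
have addS (r : seq K) (d : K -> R) :
    s0 (\sum_(z <- r) << d z *g z >>) = \sum_(z <- r) d z *: t z.
  elim: r => [|z r IH]; first by rewrite !big_nil.
  by rewrite !big_cons addD IH /s0 liftU.
move=> a y x; rewrite addD; congr (_ + _).
rewrite [LHS](addS (dom y) (fun z => a * coeff z y)).
have -> : s0 y = \sum_(z <- dom y) coeff z y *: t z.
  by rewrite -{1}[y]freeg_sumE addS.
by rewrite scaler_sumr; apply: eq_bigr => z _; rewrite scalerA.
Qed.

(** The lifting property is asked for every [p] whose image contains that of [q], so that
    it applies to maps into a submodule of [Y] without forming that submodule. *)
Definition projective F : Prop :=
  forall X Y (p : {linear X -> Y}) (q : {linear F -> Y}),
    (forall z, exists x, p x = q z) ->
  exists s : {linear F -> X}, forall z, p (s z) = q z.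

Lemma free_module_projective (K : choiceType) : projective (free_module R K).
Proof.
move=> X Y p q pq.
have /choice[t tE] : forall k : K, exists x, p x = q << k >> by move=> k; apply: pq.
have [s sE] := free_module_lift t.
exists s => z; rewrite [z]free_module_span !linear_sum; apply: eq_bigr => k _.
by rewrite !linearZ /= sE tE.
Qed.

Lemma prod_projective F G : projective F -> projective G -> projective (F * G)%type.
Proof.
move=> FP GP X Y p q pq.
have l1 : linear (fun z : F => q (z, 0)).
  move=> a x y; rewrite -linearP; congr (q _).
  by apply/pair_equal_spec; split; rewrite //= scaler0 addr0.
have l2 : linear (fun z : G => q (0, z)).
  move=> a x y; rewrite -linearP; congr (q _).
  by apply/pair_equal_spec; split; rewrite //= scaler0 addr0.
have [q1 q1E] := linear_exists l1; have [q2 q2E] := linear_exists l2.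
have [|s1 s1E] := FP X Y p q1; first by move=> z; rewrite q1E.
have [|s2 s2E] := GP X Y p q2; first by move=> z; rewrite q2E.
have [|s sE] := @linear_exists R (F * G)%type X (fun z => s1 z.1 + s2 z.2).
  by move=> a x y /=; rewrite !linearP /= scalerDr addrACA.
exists s => -[u v]; rewrite sE linearD /= s1E s2E q1E q2E -linearD; congr (q _).
by apply/pair_equal_spec; split; rewrite /= ?addr0 ?add0r.
Qed.

Definition regular_on (c : R) F : Prop := forall z : F, c *: z = 0 -> z = 0.

Lemma free_module_regular (c : R) (K : choiceType) :
  (forall r : R, c * r = 0 -> r = 0) -> regular_on c (free_module R K).
Proof.
move=> creg z cz; apply/eqP/freeg_eqP => k; rewrite coeff0; apply: creg.
by rewrite -[_ * _](coeffZ c z k) [c *: _]cz coeff0.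
Qed.

Lemma linear_divide (A V : lmodType R) (c : R) (d : {linear A -> V}) :
  regular_on c V -> (forall a, pi_multiples c (d a) = 0) ->
  exists g : {linear A -> V}, forall a, c *: g a = d a.
Proof.
move=> cV dc; have [f fE] := scale_linear V c.
have [||g gE] := @linear_lift_inj R A V V f d.
- move=> x y; rewrite !fE => xy; apply/eqP; rewrite -subr_eq0; apply/eqP/cV.
  by rewrite scalerBr xy subrr.
- by move=> a; have /pi_multiples_eq0[y yE] := dc a; exists y; rewrite fE.
by exists g => a; rewrite -fE.
Qed.

End FreeModules.

(** * Ext^1 as obstruction to extending maps *)

Section ExtOne.
Context (R : comNzRingType).
Implicit Types M N : lmodType R.

Definition syzygy_val M : {linear syzygy M -> free_module R M} :=
  @submod_val R _ (kernel (@free_cover R M)).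
Arguments syzygy_val {M}.

Lemma syzygy_valP M (s : syzygy M) : free_cover (syzygy_val s) = 0.
Proof. by apply/asboolP; exact: (valP s). Qed.

Lemma syzygy_val_ex M z : free_cover z = 0 -> exists s : syzygy M, syzygy_val s = z.
Proof. by move=> z0; have zK : z \in kernel (@free_cover R M) by [apply/asboolP]; exists (exist _ z zK). Qed.

Lemma ext1_cocycle_subproof M N (f : Hom (syzygy M) N) :
  precomp (V := N) (@free_cover R (syzygy M)) f \in kernel (codifferential M N 1).
Proof.
apply/asboolP/val_inj/funext => z /=.
rewrite /precomp /= -[RHS](Hom_fun0 f); congr (Hom_fun f _).
exact: (syzygy_valP (M := syzygy M)).
Qed.

(** A class in Ext^1(M, N) is a map from the first syzygy of M to N, up to the maps that
    extend to the free cover: a cocycle on the second free module vanishes on the second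
    syzygy and so factors through the first. *)
Definition ext1_class M N (f : Hom (syzygy M) N) : Ext 1 M N :=
  quotmod_pi (@image_in_kernel R _ _ _ (codifferential M N 0) (codifferential M N 1))
    (exist (fun h => h \in kernel (codifferential M N 1)) _
       (ext1_cocycle_subproof f)).

Lemma ext1_class_linear M N : linear (@ext1_class M N).
Proof.
move=> a f g; rewrite /ext1_class -linearP; congr (quotmod_pi _ _).
apply: (@submod_val_inj _ _ (kernel _)).
exact: (linearP (precomp (V := N) (@free_cover R (syzygy M)))).
Qed.
HB.instance Definition _ M N := GRing.isLinear.Build R (Hom (syzygy M) N) (Ext 1 M N) _
   (@ext1_class M N) (@ext1_class_linear M N).

Lemma ext1_class_eq0 M N (f : Hom (syzygy M) N) :
  ext1_class f = 0 <->
  exists g : {linear free_module R M -> N}, forall s, g (syzygy_val s) = Hom_fun f s.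
Proof.
rewrite /ext1_class -(linear0 (@quotmod_pi R _ _)); split.
  move/quotmod_piP; rewrite subr0 => /asboolP[h hE].
  have [g gE] := linear_exists (Hom_fun_linear h).
  exists g => s; have [z <-] := free_cover_surj s; rewrite gE.
  by have := congr1 (fun u : Hom _ _ => Hom_fun u z) hE.
case=> g gE; apply/quotmod_piP; rewrite subr0; apply/asboolP.
have [h hE] := Hom_of_linear g.
exists h; apply/val_inj/funext => z /=.
by rewrite /codifferential /precomp /= hE; exact: gE.
Qed.

Lemma ext1_class_surj M N (u : Ext 1 M N) : exists f, ext1_class f = u.
Proof.
rewrite -[u]quotmod_piK; case: (generic_quotient.repr u) => h hK.
have /asboolP h0 := hK.
have [h' h'E] := linear_exists (Hom_fun_linear h).
have [||f0 fE] := @linear_factor R _ _ _ (@free_cover R (syzygy M)) h'.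
- exact: free_cover_surj.
- move=> z /presentation_exact[y <-]; rewrite h'E.
  exact: (congr1 (fun v : Hom _ _ => Hom_fun v y) h0).
have [f fE'] := Hom_of_linear f0.
exists f; rewrite /ext1_class; congr (quotmod_pi _ _).
apply/val_inj/val_inj/funext => z /=.
by rewrite fE' fE h'E.
Qed.

Lemma ext1_zeroP M N : zero_module (Ext 1 M N) <->
  forall f : {linear syzygy M -> N},
  exists g : {linear free_module R M -> N}, forall s, g (syzygy_val s) = f s.
Proof.
split=> [E0 f|ext u].
  have [f' f'E] := Hom_of_linear f.
  have /ext1_class_eq0[g gE] := E0 (ext1_class f').
  by exists g => s; rewrite gE f'E.
have [f <-] := ext1_class_surj u; apply/ext1_class_eq0.
have [f' f'E] := linear_exists (Hom_fun_linear f).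
by have [g gE] := ext f'; exists g => s; rewrite gE f'E.
Qed.

End ExtOne.

Arguments syzygy_val {R M}.

(** * Faithful modules with simple socle are injective *)

Section Baer.
Context (R : comNzRingType) (M : lmodType R) (c : R).
Implicit Types I J : R^o -> Prop.

Definition annihilated I (v : M) : Prop := forall x : R, I x -> x *: v = 0.

Definition in_socle (m : R -> Prop) (v : M) : Prop := forall y, m y -> y *: v = 0.

(** The two statements of Matlis duality between ideals of R/c and submodules of M that
    an induction on I needs: I is the annihilator of its annihilator in M, and every map
    I/c -> M is multiplication by an element of M. The first makes the second go through
    when I grows, because it supplies elements of M that I kills and a given b does not. *)
Record dual_ideal I : Prop := DualIdeal {
  dual_submodule : is_submodule I;
  dual_contains : I c;
  dual_biannihilator : forall w : R, (forall v, annihilated I v -> w *: v = 0) -> I w;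
  dual_realizes : forall f : R^o -> M, linear_on I f -> f c = 0 ->
    exists v, forall x : R, I x -> f x = x *: v }.

Definition adjoin I (b : R) : R^o -> Prop :=
  fun x => exists y r, I y /\ x = y + r * b.

Lemma adjoin_submodule I b : is_submodule I -> is_submodule (adjoin I b).
Proof.
move=> IS; split=> [|a x x' [y [r [Iy ->]]] [y' [r' [Iy' ->]]]].
  by exists 0, 0; case: IS => I0 _; rewrite mul0r addr0.
exists (a * y + y'), (a * r + r'); split; first by case: IS => _; apply.
by rewrite mulrDl [_ *: _]mulrDr addrACA mulrA.
Qed.

Lemma adjoin_sub I b x : I x -> adjoin I b x.
Proof. by exists x, 0; rewrite mul0r addr0. Qed.

Lemma adjoin_gen I b : is_submodule I -> adjoin I b b.
Proof. by case=> I0 _; exists 0, 1; rewrite mul1r add0r. Qed.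

Lemma dual_ideal_ext I J : (forall x, I x <-> J x) -> dual_ideal I -> dual_ideal J.
Proof.
move=> IJ; suff -> : J = I by [].
by apply/funext=> x; apply/propext; have [? ?] := IJ x; split.
Qed.

(* M is faithful over R/c *)
Hypothesis annM : forall a : R, (forall v : M, a *: v = 0) <-> exists b, a = b * c.

Lemma dual_ideal_principal : dual_ideal (fun x => exists b, x = b * c).
Proof.
have S : is_submodule (fun x : R^o => exists b, x = b * c).
  split=> [|a x y [b ->] [b' ->]]; first by exists 0; rewrite mul0r.
  by exists (a * b + b'); rewrite mulrDl -[a * b * c]mulrA.
split=> //; first by exists 1; rewrite mul1r.
  move=> w w0; apply/annM => v; apply: w0 => x; by move/annM.
move=> f fL fc; exists 0 => x [b ->]; rewrite scaler0.
have := @linear_onZ _ R^o _ _ _ b c S fL; rewrite fc scaler0; apply.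
by exists 1; rewrite mul1r.
Qed.

Variable m : R -> Prop.
(* the socle of M has dimension at most one over R/m *)
Hypothesis socle1 : forall s t : M, in_socle m s -> in_socle m t -> t <> 0 ->
  exists r : R, s = r *: t.

(** The quotient (I + Rb) / I is killed by m. If b is not in I, some p in M is killed by I
    but not by b, and bp spans the socle. Every discrepancy between what holds for I and
    what is wanted for I + Rb lies in the socle, hence is a multiple of bp and is removed by
    adding a multiple of p (to an element of M) or of b (to an element of R). *)
Lemma dual_ideal_adjoin_simple I b :
  dual_ideal I -> (forall y, m y -> I (y * b)) -> dual_ideal (adjoin I b).
Proof.
case=> IS Ic Ibi Ire mb.
have [Ib|nIb] := EM (I b).
  have IE x : I x <-> adjoin I b x.
    split=> [|[y [r [Iy ->]]]]; first exact: adjoin_sub.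
    by apply: (@is_submoduleD _ R^o) => //; apply: (@is_submoduleZ _ R^o).
  exact: dual_ideal_ext IE _.
(* by biduality for I, some p is killed by I but not by b *)
have [p [pI pb]] : exists p, annihilated I p /\ b *: p <> 0.
  apply: contrapT => np; apply: nIb; apply: Ibi => v vI.
  by apply: contrapT => bv; apply: np; exists v.
have soc v : annihilated I v -> in_socle m (b *: v).
  by move=> vI y my; rewrite scalerA; apply: vI; apply: mb.
split.
- exact: adjoin_submodule.
- exact: adjoin_sub.
- move=> w wJ.
  have JE v : annihilated I v -> b *: v = 0 -> w *: v = 0.
    move=> vI bv; apply: wJ => x [y [r [Iy ->]]].
    by rewrite scalerDl vI // add0r -scalerA bv scaler0.
  have wp : in_socle m (w *: p).
    move=> y my; rewrite scalerA mulrC -scalerA; apply: JE.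
      by move=> x Ix; rewrite scalerA mulrC -scalerA pI // scaler0.
    by rewrite scalerA mulrC; apply: pI; apply: mb.
  have [r rE] := socle1 wp (soc p pI) pb.
  exists (w - r * b), r; split; last by rewrite subrK.
  apply: Ibi => v vI.
  have [s sE] := socle1 (soc v vI) (soc p pI) pb.
  have -> : v = (v - s *: p) + s *: p by rewrite subrK.
  have v'I : annihilated I (v - s *: p).
    by move=> x Ix; rewrite scalerBr vI // scalerA mulrC -scalerA pI // scaler0 subrr.
  have bv' : b *: (v - s *: p) = 0.
    by rewrite scalerBr sE scalerA mulrC -scalerA subrr.
  rewrite scalerDr scalerBl JE // -scalerA bv' scaler0 subrr add0r.
  by rewrite scalerA mulrC -scalerA scalerBl rE scalerA subrr scaler0.
- move=> f fL fc.
  have JS := adjoin_submodule b IS.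
  have [|v vE] := Ire f _ fc.
    by move=> a x y Ix Iy; apply: fL; apply: adjoin_sub.
  have Jb := adjoin_gen b IS.
  have fb : in_socle m (f b - b *: v).
    move=> y my; rewrite scalerBr -(linear_onZ y JS fL Jb) vE; last exact: mb.
    by rewrite scalerA subrr.
  have [r rE] := socle1 fb (soc p pI) pb.
  exists (v + r *: p) => _ [y [s [Iy ->]]].
  have -> : y + s * b = s *: (b : R^o) + y by rewrite addrC.
  rewrite fL //; last exact: adjoin_sub.
  have yp : y *: (r *: p) = 0 by rewrite scalerA mulrC -scalerA pI // scaler0.
  have fbE : f b = b *: v + r *: (b *: p) by rewrite -rE addrC subrK.
  rewrite (vE y) // scalerDl [y *: (v + _)]scalerDr yp addr0 fbE.
  congr (_ + _); rewrite -[RHS]scalerA [b *: (v + _)]scalerDr.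
  by rewrite [b *: (r *: p)]scalerA mulrC -scalerA.
Qed.

Hypothesis noethR : noetherian R.

Lemma noetherian_gen I : is_submodule I ->
  exists n (g : 'I_n -> R), (forall i, I (g i)) /\
    forall x, I x -> exists a : 'I_n -> R, x = \sum_i a i * g i.
Proof.
move=> IS.
have [J JE] := submodClosed_exists IS.
have [n [g gE]] := noethR J.
exists n, (fun i => submod_val (g i)); split=> [i|x Ix].
  by apply/JE; exact: (valP (g i)).
have xJ : x \in J by apply/JE.
have [a aE] := gE (exist (fun y : R^o => y \in J) x xJ).
by exists a; have := congr1 (@submod_val _ _ J) aE; rewrite linear_sum.
Qed.

Hypothesis m_sub : is_submodule (m : R^o -> Prop).
Hypothesis m_nil : forall x, m x -> exists n b, x ^+ n = b * c.

(** The generators of m are nilpotent modulo c, so I + Rb is reached from I by adding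
    finitely many multiples of b, each of which m sends into the ideal already built. The
    induction is on the number of generators of m that may fail to send b into I. *)
Lemma dual_ideal_adjoin I b : dual_ideal I -> dual_ideal (adjoin I b).
Proof.
have [n [g [mg mE]]] := noetherian_gen m_sub.
have step : forall j, (j <= n)%N -> forall I b, dual_ideal I ->
    (forall i : 'I_n, (j <= i)%N -> I (g i * b)) -> dual_ideal (adjoin I b).
  elim=> [_|j IHj jn] {}I {}b DI gb.
    apply: dual_ideal_adjoin_simple => // y /mE[a ->].
    have IS := dual_submodule DI.
    rewrite mulr_suml; elim/big_ind : _ => [|u v|i _]; first by case: IS.
      exact: (@is_submoduleD _ R^o).
    by rewrite -mulrA; apply: (@is_submoduleZ _ R^o) => //; apply: gb.
  pose x := g (Ordinal jn).
  have [N [d xN]] := m_nil (mg (Ordinal jn)).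
  (* x ^+ N * b is in I already; adjoin x ^+ (N - 1) * b, then x ^+ (N - 2) * b, up to b *)
  suff : forall k, exists J, [/\ dual_ideal J, forall y, I y -> J y,
      J (x ^+ (N - k) * b) & forall y, J y -> adjoin I b y].
    move=> /(_ N)[J [DJ IJ]]; rewrite subnn expr0 mul1r => Jb JI.
    have JS := dual_submodule DJ.
    apply: dual_ideal_ext DJ => y; split=> [/JI //|[u [r [Iu ->]]]].
    apply: (@is_submoduleD _ R^o) => //; first exact: IJ.
    exact: (@is_submoduleZ _ R^o).
  have IS := dual_submodule DI.
  elim=> [|k [J [DJ IJ Jb JI]]].
    exists I; split=> //; last exact: adjoin_sub.
    rewrite subn0 [x ^+ N]xN mulrAC; apply: (@is_submoduleZ _ R^o) => //.
    exact: dual_contains.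
  have JS := dual_submodule DJ.
  exists (adjoin J (x ^+ (N - k.+1) * b)); split.
  - apply: IHj => //; first exact: ltnW.
    move=> i; rewrite leq_eqVlt => /orP[/eqP ij|ji].
      have -> : g i = x by congr g; apply: val_inj.
      rewrite mulrA -exprS; have [kN|kN] := ltnP k N; first by rewrite -subSn.
      have e1 : (N - k = 0)%N by apply/eqP; rewrite subn_eq0.
      have e2 : (N - k.+1 = 0)%N by apply/eqP; rewrite subn_eq0 leqW.
      move: Jb; rewrite e1 e2 expr0 mul1r expr1 => Jb.
      exact: (@is_submoduleZ _ R^o).
    rewrite mulrCA; apply: (@is_submoduleZ _ R^o) => //; exact/IJ/gb.
  - by move=> y Iy; apply/adjoin_sub/IJ.
  - exact: adjoin_gen.
  - move=> y [u [r [/JI[v [s [Iv ->]]] ->]]].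
    exists v, (s + r * x ^+ (N - k.+1)); split=> //.
    by rewrite -addrA mulrDl mulrA.
move=> DI; apply: (step n) => // i; rewrite leqNgt ltn_ord //.
Qed.

Lemma dual_ideal_all I : is_submodule I -> I c -> dual_ideal I.
Proof.
move=> IS Ic; have [n [g [Ig gE]]] := noetherian_gen IS.
suff : forall k, exists J, [/\ dual_ideal J, forall y, J y -> I y &
    forall i : 'I_n, (i < k)%N -> J (g i)].
  move=> /(_ n)[J [DJ JI Jg]]; have JS := dual_submodule DJ.
  apply: dual_ideal_ext DJ => y; split; first exact: JI.
  move=> /gE[a ->].
  elim/big_ind : _ => [|u v|i _]; first by case: JS.
    exact: (@is_submoduleD _ R^o).
  by apply: (@is_submoduleZ _ R^o) => //; apply: Jg.
elim=> [|k [J [DJ JI Jg]]].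
  exists (fun x => exists b, x = b * c); split=> //; first exact: dual_ideal_principal.
  by move=> _ [b ->]; apply: (@is_submoduleZ _ R^o).
have [kn|nk] := ltnP k n; last first.
  by exists J; split=> // i _; apply: Jg; apply: leq_trans (ltn_ord i) _.
have JS := dual_submodule DJ.
exists (adjoin J (g (Ordinal kn))); split.
- exact: dual_ideal_adjoin.
- move=> _ [u [r [/JI Iu ->]]]; apply: (@is_submoduleD _ R^o) => //.
  exact: (@is_submoduleZ _ R^o).
- move=> i; rewrite ltnS leq_eqVlt => /orP[/eqP ik|ik].
    have -> : i = Ordinal kn by apply: val_inj.
    exact: adjoin_gen.
  exact/adjoin_sub/Jg.
Qed.

Section Extension.
Variables (U T : lmodType R) (iota : {linear U -> T}) (f : {linear U -> M}).
Hypothesis f_c : forall u t, iota u = c *: t -> f u = 0.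

Definition functional_graph (G : T * M -> Prop) : Prop :=
  is_submodule G /\ forall y, G (0, y) -> y = 0.

(** The graph of f, together with the zero map on cT: a map into M extends to T only if it
    is compatible with M being killed by c. *)
Definition start_graph : set (T * M) :=
  fun p => exists u t, p = (iota u + c *: t, f u).

Lemma start_graph_functional : functional_graph start_graph.
Proof.
split.
  split=> [|a _ _ [u [t ->]] [u' [t' ->]]].
    by exists 0, 0; rewrite !linear0 ?scaler0 ?addr0.
  exists (a *: u + u'), (a *: t + t'); rewrite !linearP /=.
  apply/pair_equal_spec; split=> //=.
  by rewrite !scalerDr addrACA !scalerA [a * c]mulrC.
move=> y [u [t /pair_equal_spec[ut ->]]].
apply: (f_c (t := - t)); rewrite scalerN.
by apply/eqP; rewrite -addr_eq0 ut.
Qed.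

Lemma functional_graph_eq G t y y' :
  functional_graph G -> G (t, y) -> G (t, y') -> y = y'.
Proof.
move=> [GS G0] Gy Gy'; apply/eqP; rewrite -subr_eq0; apply/eqP/G0.
by rewrite -(subrr t); apply: (is_submoduleB GS Gy Gy').
Qed.

(** Baer's step: the r with rt in the domain of G form an ideal containing c, and the map
    from it to M is multiplication by some v, which is the value to give to t. *)
Lemma functional_graph_extend G t : functional_graph G ->
  (forall p, start_graph p -> G p) ->
  exists H, [/\ functional_graph H, forall p, G p -> H p & exists y, H (t, y)].
Proof.
move=> GF SG; have [GS G0] := GF; have [G00 GL] := GS.
pose J : R^o -> Prop := fun r => exists y, G (r *: t, y).
have JS : is_submodule J.
  split=> [|a r s [y Gy] [y' Gy']]; first by exists 0; rewrite scale0r.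
  by exists (a *: y + y'); rewrite scalerDl -scalerA; exact: (GL a _ _ Gy Gy').
have Gc s : G (c *: s, 0).
  by apply: SG; exists 0, s; rewrite !linear0 add0r.
have Jc : J c by exists 0.
have /choice[h hE] : forall r : R^o, exists y, J r -> G (r *: t, y).
  by move=> r; have [[y Gy]|nJ] := EM (J r); [exists y|exists 0].
have [||v vE] := dual_realizes (dual_ideal_all JS Jc) (f := h).
- move=> a r s Jr Js; apply: functional_graph_eq GF (hE _ _) _.
    by case: JS => _; apply.
  by rewrite scalerDl -scalerA; exact: (GL a _ _ (hE _ Jr) (hE _ Js)).
- exact: functional_graph_eq GF (hE _ Jc) _.
exists (fun p => exists r q, G q /\ p = (q.1 + r *: t, q.2 + r *: v)); split.
- split; first split.
  + by exists 0, 0; split=> //; rewrite !scale0r !addr0.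
  + move=> a _ _ [r [q [Gq ->]]] [r' [q' [Gq' ->]]].
    exists (a * r + r'), (a *: q + q'); split; first exact: GL.
    apply/pair_equal_spec; split=> /=;
      by rewrite scalerDr scalerDl -scalerA addrACA.
  + move=> y [r [[q1 q2] [Gq /pair_equal_spec[/= qr ->]]]].
    have Gr : G (r *: t, - q2).
      have := is_submoduleZ (-1) GS Gq; rewrite (_ : -1 *: (q1, q2) = (r *: t, - q2)) //.
      apply/pair_equal_spec; split; rewrite /= scaleN1r //.
      by apply/eqP; rewrite eq_sym -addr_eq0 addrC -qr.
    have Jr : J r by exists (- q2).
    by rewrite -vE // (functional_graph_eq GF (hE _ Jr) Gr) subrr.
- by move=> [p1 p2] Gp; exists 0, (p1, p2); rewrite /= !scale0r !addr0.
- by exists v, 1, 0; split=> //=; rewrite !scale1r !add0r.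
Qed.

(** M is injective over R/c: a maximal functional graph, given by Zorn's lemma, is total. *)
Lemma injective_extension : exists h : {linear T -> M}, forall u, h (iota u) = f u.
Proof.
(* uniting with the starting graph makes the empty chain harmless *)
pose P : set (set (T * M)) := fun X => functional_graph (X `|` start_graph)%classic.
have [F FP Ftot|G [PG Gmax]] := @Zorn_bigcup _ P.
  have S0 := start_graph_functional.
  have two p q : ((\bigcup_(X in F) X) `|` start_graph)%classic p ->
      ((\bigcup_(X in F) X) `|` start_graph)%classic q ->
      exists Y : set (T * M), [/\ functional_graph Y, Y p, Y q &
        forall r, Y r -> ((\bigcup_(X in F) X) `|` start_graph)%classic r].
    have sub X : F X -> forall r, (X `|` start_graph)%classic r ->
        ((\bigcup_(X in F) X) `|` start_graph)%classic r.
      by move=> FX r [Xr|]; [left; exists X|right].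
    move=> [[X FX Xp]|Sp] [[Y FY Yq]|Sq].
    - have [XY|YX] := Ftot _ _ FX FY.
        exists (Y `|` start_graph)%classic; split; [exact: FP|left; exact: XY|by left|].
        exact: sub.
      exists (X `|` start_graph)%classic; split; [exact: FP|by left|left; exact: YX|].
      exact: sub.
    - exists (X `|` start_graph)%classic; split; [exact: FP|by left|by right|].
      exact: sub.
    - exists (Y `|` start_graph)%classic; split; [exact: FP|by right|by left|].
      exact: sub.
    - by exists start_graph; split=> // r; right.
  split; first split.
  - by right; case: S0 => -[].
  - move=> a p q Gp Gq; have [Y [[[_ YL] _] Yp Yq YG]] := two p q Gp Gq.
    exact/YG/YL.
  - move=> y Gy; have [Y [[_ Y0] Yp _ _]] := two _ _ Gy Gy.
    exact: Y0.
have SG p : start_graph p -> (G `|` start_graph)%classic p by right.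
have tot t : exists y, (G `|` start_graph)%classic (t, y).
  have [H [HF GH [y Hy]]] := functional_graph_extend t PG SG.
  exists y; apply: contrapT => nGy; apply: (Gmax H).
    split=> [p Gp|HG]; first by apply: GH; left.
    by apply: nGy; left; apply: HG.
  rewrite /P (_ : (H `|` start_graph)%classic = H) //.
  by apply/setUidPl => p Sp; apply/GH/SG.
have /choice[h hE] := tot.
have [a x y|h' h'E] := @linear_exists R T M h.
  have [[_ GL] _] := PG.
  by apply: functional_graph_eq PG (hE _) _; exact: (GL a _ _ (hE x) (hE y)).
exists h' => u; rewrite h'E; apply: functional_graph_eq PG (hE _) _.
by apply: SG; exists u, 0; rewrite scaler0 addr0.
Qed.

End Extension.
End Baer.

(** * Vanishing of Ext from the injectivity of P / cP *)

Lemma Ext_shift (R : comNzRingType) i (M N : lmodType R) :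
  Ext i.+1 M N = Ext 1 (iter i (@syzygy R) M) N.
Proof.
(* once unfolded, the two homology modules are the same term *)
cbv beta delta [Ext codifferential differential resolution iter] iota.
exact: erefl.
Qed.

Section ExtVanishing.
Context (R : comNzRingType) (c : R).
Implicit Types S F G K B N : lmodType R.

Definition short_exact K B S (j : {linear K -> B}) (phi : {linear B -> S}) : Prop :=
  [/\ injective j, forall b, phi b = 0 <-> exists k, j k = b &
      forall s, exists b, phi b = s].

Lemma syzygy_exact N : short_exact (@syzygy_val R N) (@free_cover R N).
Proof.
split; [exact: submod_val_inj| |exact: free_cover_surj].
move=> z; split; first exact: syzygy_val_ex.
by case=> k <-; exact: syzygy_valP.
Qed.

(** Up to a projective summand G, the module S is the first syzygy of the c-torsion module
    F / iota(S * G). The summand is what makes the class stable under taking syzygies. *)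
Definition torsion_syzygy S : Prop :=
  exists G F (iota : {linear (S * G)%type -> F}),
    [/\ projective G /\ regular_on c G, projective F /\ regular_on c F,
        injective iota & forall z, exists w, iota w = c *: z].

Lemma regular_prod F G : regular_on c F -> regular_on c G -> regular_on c (F * G)%type.
Proof.
move=> cF cG [u v] /pair_equal_spec[/= cu cv].
by apply/pair_equal_spec; split; [apply: cF|apply: cG].
Qed.

(** Since the image of iota contains cF, multiplication by c on F factors through phi. *)
Lemma torsion_syzygy_lift S G F B (iota : {linear (S * G)%type -> F}) (phi : {linear B -> (S * G)%type}) :
  projective F -> (forall z, exists w, iota w = c *: z) -> (forall s, exists b, phi b = s) ->
  exists sigma : {linear F -> B}, forall z, iota (phi (sigma z)) = c *: z.
Proof.
move=> FP iotac phiS; have [q qE] := scale_linear F c.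
have [|s sE] := FP B F (iota \o phi) q.
  by move=> z; have [w wE] := iotac z; have [b bE] := phiS w; exists b; rewrite /= bE wE.
by exists s => z; rewrite -qE -sE.
Qed.

(** If cN = 0, the first syzygy of N contains c times the free cover of N. *)
Lemma torsion_syzygy_base N :
  (forall r : R, c * r = 0 -> r = 0) -> (forall x : N, c *: x = 0) ->
  torsion_syzygy (syzygy N).
Proof.
move=> creg cN.
have FP := @free_module_projective R N.
have Fc := @free_module_regular R c N creg.
have [iota iotaE] := pair_linear (@syzygy_val R N) (idfun : {linear free_module R N -> _}).
exists (free_module R N), (free_module R N * free_module R N)%type, iota; split=> //.
- by split; [exact: prod_projective|exact: regular_prod].
- move=> [x y] [x' y']; rewrite !iotaE /= => /pair_equal_spec[xx ->].
  by congr pair; apply: submod_val_inj xx.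
- move=> [u v]; have [|s sE] := @syzygy_val_ex R N (c *: u).
    by rewrite linearZ /= cN.
  by exists (s, c *: v); rewrite iotaE /= sE.
Qed.

(** View S * G as a submodule of F that contains cF. The preimage of cF in the cover B * G
    of S * G is K plus a lift of cF, a copy of the projective module F, and it contains
    c(B * G). So K * F is the first syzygy of a c-torsion module. *)
Lemma torsion_syzygy_step K B S (j : {linear K -> B}) (phi : {linear B -> S}) :
  short_exact j phi -> projective B -> regular_on c B ->
  torsion_syzygy S -> torsion_syzygy K.
Proof.
move=> [jI jK phiS] BP Bc [G [F [iota [[GP Gc] [FP Fc] iotaI iotac]]]].
have [phi' phi'E] := pair_linear phi (idfun : {linear G -> G}).
have [|sigma sigmaE] := @torsion_syzygy_lift S G F (B * G)%type iota phi' FP iotac.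
  by move=> [s g]; have [b bE] := phiS s; exists (b, g); rewrite phi'E /= bE.
have [i iE] := inl_linear B G.
have phij k : phi (j k) = 0 by apply/jK; exists k.
have [|kappa kappaE] := @linear_exists R (K * F)%type (B * G)%type
    (fun w => i (j w.1) + sigma w.2).
  by move=> a x y /=; rewrite !linearP /= scalerDr addrACA.
have phi'i k : phi' (i (j k)) = 0 by rewrite phi'E iE /= phij.
exists F, (B * G)%type, kappa; split=> //.
- by split; [exact: prod_projective|exact: regular_prod].
- apply: linear_inj0 => -[k z]; rewrite kappaE /= => kz.
  have z0 : z = 0.
    apply: Fc; rewrite -sigmaE.
    have := congr1 (fun w => iota (phi' w)) kz.
    by rewrite linearD /= phi'i add0r !linear0.
  move: kz; rewrite z0 linear0 addr0 iE => /pair_equal_spec[jk _].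
  by apply/pair_equal_spec; split=> //; apply: jI; rewrite jk linear0.
- move=> w; pose z := iota (phi' w).
  have : phi' (c *: w - sigma z) = 0.
    by apply: iotaI; rewrite linear0 linearB linearB /= sigmaE linearZ linearZ /= subrr.
  rewrite phi'E => /pair_equal_spec[/jK[k kE] /= wz].
  exists (k, z); rewrite kappaE /= iE kE.
  apply/eqP; rewrite eq_sym -subr_eq; apply/eqP.
  by apply/pair_equal_spec; split.
Qed.

Variable P : lmodType R.
Hypothesis Pc : regular_on c P.
(* P / cP is injective over R/c *)
Hypothesis P_ext : forall (U T : lmodType R) (iota : {linear U -> T})
    (f : {linear U -> quot_multiples P c}),
  (forall u t, iota u = c *: t -> f u = 0) ->
  exists h : {linear T -> quot_multiples P c}, forall u, h (iota u) = f u.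

(** This is Ext^1(S, P) = 0 for a torsion syzygy S. Replace S by S * G and B by B * G, and let
    sigma lift multiplication by c on F to B; then e(u) = cu - sigma(iota(phi u)) lies in K.
    If g extends f, then c g(u) = f(e u) - h(iota(phi u)) where h = - g o sigma is a map
    F -> P. Conversely, a map h for which the right-hand side is always divisible by c gives
    an extension g. Modulo c this prescribes h on the image of iota, with value 0 on cF; the
    injectivity of P / cP extends it to F, and projectivity of F lifts it to P. *)
Lemma torsion_syzygy_extend K B S (j : {linear K -> B}) (phi : {linear B -> S})
    (f : {linear K -> P}) :
  short_exact j phi -> torsion_syzygy S ->
  exists g : {linear B -> P}, forall k, g (j k) = f k.
Proof.
move=> [jI0 jK0 phiS0] [G [F [iota [_ [FP Fc] iotaI iotac]]]].
have [phi' phi'E] := pair_linear phi (idfun : {linear G -> G}).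
have [i iE] := inl_linear B G.
have phiS w : exists b, phi' b = w.
  by case: w => s g; have [b bE] := phiS0 s; exists (b, g); rewrite phi'E /= bE.
have jK b : phi' b = 0 <-> exists k, i (j k) = b.
  case: b => b g; rewrite phi'E; split.
    by move=> [/jK0[k kb] g0]; exists k; rewrite iE kb -g0.
  case=> k; rewrite iE => -[<- <-].
  by apply/pair_equal_spec; split=> //; apply/jK0; exists k.
have jI : injective (i \o j).
  by move=> k k' /=; rewrite !iE => /pair_equal_spec[/jI0].
have [sigma sigmaE] := torsion_syzygy_lift FP iotac phiS.
have [|e0 e0E] := @linear_exists R (B * G)%type (B * G)%type
    (fun u => c *: u - sigma (iota (phi' u))).
  move=> a x y; rewrite (linearP phi') (linearP iota) (linearP sigma).
  by rewrite scalerDr scalerBr !scalerA [c * a]mulrC opprD addrACA.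
have [|e eE] := linear_lift_inj (e := e0) jI.
  move=> u; apply/jK; rewrite e0E; apply: iotaI.
  by rewrite linear0 linearB linearB /= sigmaE linearZ linearZ /= subrr.
have ej k : e (i (j k)) = c *: k.
  apply: jI; rewrite eE e0E (_ : phi' _ = 0); last by apply/jK; exists k.
  by rewrite !linear0 addr0 /= !linearZ.
pose theta : {linear (B * G)%type -> quot_multiples P c} := pi_multiples c \o f \o e.
have [||psi psiE] := @linear_factor R _ _ _ phi' theta.
- exact: phiS.
- move=> u /jK[k <-]; rewrite /theta /= ej linearZ; apply/pi_multiples_eq0.
  by exists (f k).
have psi0 s z : iota s = c *: z -> psi s = 0.
  rewrite -sigmaE => /iotaI ->; rewrite psiE /theta /=.
  have -> : e (sigma z) = 0; last by rewrite !linear0.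
  apply: jI; rewrite linear0 eE e0E sigmaE linearZ subrr //.
have [H HE] := P_ext psi0.
have [|h hE] := FP P (quot_multiples P c) (pi_multiples c) H.
  by move=> z; exact: pi_multiples_surj.
have [|d dE] := @linear_exists R (B * G)%type P (fun u => f (e u) - h (iota (phi' u))).
  move=> a x y; rewrite (linearP e) (linearP f) (linearP phi') (linearP iota).
  by rewrite (linearP h) scalerBr opprD addrACA.
have [|g gE] := @linear_divide R _ _ c d Pc.
  by move=> u; rewrite dE linearB /= hE HE psiE subrr.
exists (g \o i) => k /=.
apply/eqP; rewrite -subr_eq0; apply/eqP/Pc; rewrite scalerBr gE dE ej linearZ.
have -> : phi' (i (j k)) = 0 by apply/jK; exists k.
by rewrite !linear0 addr0 subrr.
Qed.

Hypothesis creg : forall r : R, c * r = 0 -> r = 0.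

Lemma Ext_higher_zero N i : (forall x : N, c *: x = 0) -> zero_module (Ext i.+2 N P).
Proof.
move=> cN; suff TS : torsion_syzygy (iter i.+1 (@syzygy R) N).
  rewrite Ext_shift; apply/ext1_zeroP => f.
  exact: torsion_syzygy_extend (syzygy_exact _) TS.
elim: i => [|i IH]; first exact: torsion_syzygy_base.
apply: torsion_syzygy_step (syzygy_exact _) _ _ IH.
  exact: free_module_projective.
exact: free_module_regular.
Qed.

Lemma Ext0_zero N : (forall x : N, c *: x = 0) -> zero_module (Ext 0 N P).
Proof.
move=> cN u; rewrite -[u]quotmod_piK; case: (generic_quotient.repr u) => h hK.
rewrite -(linear0 (@quotmod_pi R _ _)); congr (quotmod_pi _ _).
apply/val_inj/val_inj/funext => z /=; apply: Pc.
have [h' h'E] := linear_exists (Hom_fun_linear h).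
rewrite -[val h z]h'E -linearZ h'E.
have [|y <-] := (presentation_exact (c *: z : free_module R N)).1.
  by rewrite linearZ /= cN.
have /asboolP h0 := hK.
exact: (congr1 (fun v : Hom _ _ => Hom_fun v y) h0).
Qed.

End ExtVanishing.

(** * Ext^1 of the residue field and the socle *)

Section Residue.
Context (R : comNzRingType) (m : ideal R).
Hypothesis m_max : maximal_ideal m.

Lemma residue_eq0 (r : R) : quotmod_pi m r = 0 <-> r \in m.
Proof. by rewrite -(linear0 (@quotmod_pi R _ m)) quotmod_piP subr0. Qed.

Lemma residue_killed (x : residue_field m) y : y \in m -> y *: x = 0.
Proof.
move=> ym; rewrite -[x]quotmod_piK -linearZ; apply/residue_eq0.
by rewrite /= [y *: _]mulrC; apply: rpredZ.
Qed.

Lemma maximal_ideal_unit r : r \notin m -> exists s, 1 - s * r \in m.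
Proof.
move=> rm.
have mS : is_submodule (fun x : R^o => x \in m) by exact: submodClosed_is_submodule.
have [J JE] := submodClosed_exists (adjoin_submodule r mS).
have mJ : {subset m <= J} by move=> x xm; apply/JE/adjoin_sub.
have [|J1] := boolP (1 \in J).
  by move=> /JE[y [s [ym ->]]]; exists s; rewrite addrK.
case/negP: rm; have [_ /(_ J mJ J1) ->] := m_max.
by apply/JE/adjoin_gen.
Qed.

Lemma isomorphic_residue (V : lmodType R) (u : V) :
  (forall v, exists r : R, v = r *: u) -> (forall r : R, r *: u = 0 <-> r \in m) ->
  isomorphic V (residue_field m).
Proof.
move=> ugen uann; apply: isomorphic_sym.
have [|f fE] := @linear_exists R R^o V (fun r : R => r *: u).
  by move=> a x y; rewrite scalerDl -scalerA.
have [||g gE] := @linear_factor R R^o _ V (@quotmod_pi R _ m) f.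
- by move=> x; exists (generic_quotient.repr x); exact: quotmod_piK.
- by move=> r /residue_eq0 rm; rewrite fE; apply/uann.
exists g.
have gI : injective g.
  apply: linear_inj0 => x; rewrite -[x]quotmod_piK gE fE => /uann rm.
  exact/residue_eq0.
have /choice[h hE] := ugen.
exists (fun v => quotmod_pi m (h v : R^o)) => [x|v]; last by rewrite gE fE -hE.
by apply: gI; rewrite gE fE -hE.
Qed.

Variables (c : R) (P : lmodType R).
Hypotheses (cm : c \in m) (Pc : regular_on c P).
Local Notation M := (quot_multiples P c).
Local Notation socle := (in_socle (fun y : R => y \in m)).

Lemma socle_map (s : M) : socle s ->
  exists chi : {linear residue_field m -> M}, forall r : R, chi (quotmod_pi m r) = r *: s.
Proof.
move=> sS; have [|f fE] := @linear_exists R R^o M (fun r : R => r *: s).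
  by move=> a x y; rewrite scalerDl -scalerA.
have [||g gE] := @linear_factor R R^o _ M (@quotmod_pi R _ m) f.
- by move=> x; exists (generic_quotient.repr x); exact: quotmod_piK.
- by move=> r /residue_eq0 rm; rewrite fE; apply: sS.
by exists g => r; rewrite gE fE.
Qed.

Local Notation k := (residue_field m).
Local Notation F0 := (free_module R k).
Definition residue_gen : F0 := << (quotmod_pi m (1 : R^o) : k) >>.

Lemma free_cover_gen (r : R) : free_cover (r *: residue_gen) = quotmod_pi m r.
Proof.
rewrite linearZ /= {1}/free_cover liftU scale1r -linearZ; congr (quotmod_pi _ _).
exact: mulr1.
Qed.

(** Since c kills k, c times the free cover of k lies in its kernel. *)
Lemma scale_to_syzygy : exists D : {linear F0 -> syzygy k}, forall z, syzygy_val (D z) = c *: z.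
Proof.
have [f fE] := scale_linear F0 c.
have [|//|D DE] := @linear_lift_inj R F0 (syzygy k) F0 (@syzygy_val R k) f.
- exact: submod_val_inj.
- by move=> z; apply: syzygy_val_ex; rewrite fE linearZ /= residue_killed.
by exists D => z; rewrite DE fE.
Qed.

Section Class.
Variables (D : {linear F0 -> syzygy k}) (DE : forall z, syzygy_val (D z) = c *: z).

Lemma scale_to_syzygy_val t : D (syzygy_val t) = c *: t.
Proof. by apply: submod_val_inj; rewrite [LHS]DE [RHS]linearZ. Qed.

(** Evaluating at c times the generator is the isomorphism of Ext^1(k, P) with
    Hom(k, P / cP), the socle of P / cP. The value lies in the socle because y times the
    generator is a syzygy t for y in m, and f(ct) = c f(t). *)
Lemma ext_socle (f : {linear syzygy k -> P}) : socle (pi_multiples c (f (D residue_gen))).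
Proof.
move=> y ym; have [|t tE] := @syzygy_val_ex R k (y *: residue_gen).
  by rewrite free_cover_gen; apply/residue_eq0.
have -> : y *: pi_multiples c (f (D residue_gen)) =
    pi_multiples c (f (D (y *: residue_gen))) by rewrite !linearZ.
rewrite -tE scale_to_syzygy_val; apply/pi_multiples_eq0; exists (f t).
by rewrite linearZ.
Qed.

(** An extension g satisfies c g(z) = f(cz), and f(cz) / c is an extension as soon as f(cz)
    is divisible by c for all z; it suffices to test the generator, as the cover is spanned
    by it and by syzygies. *)
Lemma ext_extendsP (f : {linear syzygy k -> P}) :
  pi_multiples c (f (D residue_gen)) = 0 <->
  exists g : {linear F0 -> P}, forall s, g (syzygy_val s) = f s.
Proof.
split=> [f0|[g gE]]; last first.
  by rewrite -gE DE linearZ; apply/pi_multiples_eq0; exists (g residue_gen).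
have [|g gE] := @linear_divide R _ _ c (f \o D) Pc.
  move=> z; pose r : R := generic_quotient.repr (free_cover z).
  have [|t tE] := @syzygy_val_ex R k (z - r *: residue_gen).
    by rewrite linearB /= free_cover_gen quotmod_piK subrr.
  have -> : z = r *: residue_gen + syzygy_val t by rewrite tE addrC subrK.
  rewrite /= (linearD D) (linearD f) (linearD (pi_multiples c)).
  rewrite !linearZ /= f0 scaler0 add0r scale_to_syzygy_val linearZ.
  by apply/pi_multiples_eq0; exists (f t).
exists g => t; apply/eqP; rewrite -subr_eq0; apply/eqP/Pc.
by rewrite scalerBr gE /= scale_to_syzygy_val linearZ subrr.
Qed.

(** A socle element s is a map k -> P / cP; lift its composite with the cover to P and divide
    by c on the syzygy. *)
Lemma ext_realize (s : M) : socle s ->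
  exists f : {linear syzygy k -> P}, pi_multiples c (f (D residue_gen)) = s.
Proof.
move=> sS; have [chi chiE] := socle_map sS.
have [|H HE] := @free_module_projective R k _ _ (pi_multiples c) (chi \o @free_cover R k).
  by move=> z; exact: pi_multiples_surj.
have [|f fE] := @linear_divide R _ _ c (H \o @syzygy_val R k) Pc.
  by move=> t; rewrite /= HE /= syzygy_valP linear0.
exists f; have -> : f (D residue_gen) = H residue_gen.
  apply/eqP; rewrite -subr_eq0; apply/eqP/Pc.
  by rewrite scalerBr fE /= DE linearZ subrr.
by rewrite HE /= -[residue_gen]scale1r free_cover_gen chiE scale1r.
Qed.

End Class.

Lemma Ext1_residue (s0 : M) : socle s0 -> s0 <> 0 ->
  (forall s, socle s -> exists r : R, s = r *: s0) ->
  isomorphic (Ext 1 k P) k.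
Proof.
move=> s0S s0N gen; have [D DE] := scale_to_syzygy.
have [f0 f0E] := ext_realize DE s0S.
have [h0 h0E] := Hom_of_linear f0.
have cls (h : Hom (syzygy k) P) : ext1_class h = 0 <->
    pi_multiples c (Hom_fun h (D residue_gen)) = 0.
  have [f fE] := linear_exists (Hom_fun_linear h).
  rewrite -fE (ext_extendsP DE) ext1_class_eq0.
  by split=> -[g gE]; exists g => s; rewrite gE fE.
apply: (@isomorphic_residue _ (ext1_class h0)) => [v|r].
  have [h <-] := ext1_class_surj v.
  have [f fE] := linear_exists (Hom_fun_linear h).
  have [r rE] := gen _ (ext_socle DE f).
  exists r; apply/eqP; rewrite -subr_eq0 -linearZ -linearB; apply/eqP/cls.
  rewrite [Hom_fun _ _](_ : _ = Hom_fun h (D residue_gen) - r *: Hom_fun h0 (D residue_gen)) //.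
  by rewrite linearB linearZ /= h0E f0E -rE fE subrr.
rewrite -linearZ cls.
rewrite [Hom_fun _ _](_ : _ = r *: Hom_fun h0 (D residue_gen)) //.
rewrite linearZ /= h0E f0E; split=> [rs0|]; last exact: s0S.
apply: contrapT => /negP /maximal_ideal_unit[s sm]; apply: s0N.
by rewrite -[s0]scale1r -[1](subrK (s * r)) scalerDl s0S // -scalerA rs0 scaler0 addr0.
Qed.

End Residue.

(** * The socle of P / cP for a precanonical ideal P *)

Section IdealSocle.
Context (R : comNzRingType) (m P : ideal R).
Hypothesis m_max : maximal_ideal m.
Local Notation PP := (submod_type P).
Local Notation k := (residue_field m).
Variable c : PP.
Local Notation x := (submod_val c : R).
Hypothesis creg : forall r : R, x * r = 0 -> r = 0.
Hypothesis P_closed : closed_ideal P.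
Hypothesis P_ext : zero_module (Ext 1 PP PP).
Local Notation M := (quot_multiples PP x).
Local Notation socle := (in_socle (fun y : R => y \in m)).

Lemma ideal_scaleC (p q : PP) : (submod_val p : R) *: q = (submod_val q : R) *: p.
Proof. by apply: submod_val_inj; rewrite !linearZ /=; exact: mulrC. Qed.

Lemma ideal_regular : regular_on x PP.
Proof.
move=> p /(congr1 (@submod_val _ _ P)); rewrite linearZ linear0 => /creg p0.
by apply: submod_val_inj; rewrite linear0.
Qed.

Lemma closed_homothety (theta : {linear PP -> PP}) : exists r : R, forall p, theta p = r *: p.
Proof.
have [g gE] := Hom_of_linear theta; have [h _ hK] := P_closed.
by exists (h g) => p; rewrite -gE -[g in LHS]hK.
Qed.

(** If aP lies in cP, then p |-> ap / c is an endomorphism of P, hence multiplication by some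
    r because P is closed; at p = c this reads a = rc. *)
Lemma quotient_faithful (a : R) : (forall v : M, a *: v = 0) <-> exists b, a = b * x.
Proof.
split=> [a0|[b ->] v]; last first.
  have [p <-] := pi_multiples_surj v; rewrite -linearZ; apply/pi_multiples_eq0.
  by exists (b *: p); rewrite !scalerA mulrC.
have [f fE] := scale_linear PP a.
have [|theta thetaE] := @linear_divide R _ _ x f ideal_regular.
  by move=> p; rewrite fE linearZ; exact: a0.
have [r rE] := closed_homothety theta.
exists r; have := thetaE c; rewrite rE fE => /(congr1 (@submod_val _ _ P)).
rewrite !linearZ => xrx; apply/eqP; rewrite -subr_eq0; apply/eqP/creg.
by rewrite mulrBr (mulrC x a) [r * x]mulrC -[x * (x * r)]mulrC -mulrA; apply/eqP; rewrite subr_eq0 eq_sym; apply/eqP.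
Qed.

(** Ext^1(P, P) = 0 lifts a map P -> P / cP to an endomorphism of P, which is a scalar because
    P is closed. *)
Lemma lift_to_multiplication (g : {linear PP -> M}) :
  exists r : R, forall p, g p = pi_multiples x (r *: p).
Proof.
have [|G GE] := @free_module_projective R PP _ _ (pi_multiples x) (g \o @free_cover R PP).
  by move=> z; exact: pi_multiples_surj.
have [|f fE] := @linear_divide R _ _ x (G \o @syzygy_val R PP) ideal_regular.
  by move=> t; rewrite /= GE /= syzygy_valP linear0.
have [h hE] := (ext1_zeroP PP PP).1 P_ext f.
have [|d dE] := @linear_exists R (free_module R PP) PP (fun z => G z - x *: h z).
  move=> a y z; rewrite (linearP G) (linearP h) scalerDr scalerBr !scalerA.
  by rewrite [x * a]mulrC opprD addrACA.
have [||theta thetaE] := @linear_factor R _ _ _ (@free_cover R PP) d.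
- exact: free_cover_surj.
- by move=> z /syzygy_val_ex[t <-]; rewrite dE hE fE subrr.
have [r rE] := closed_homothety theta.
exists r => p; have [z <-] := free_cover_surj p.
rewrite -rE thetaE dE (linearB (pi_multiples x)) GE /=.
rewrite (_ : pi_multiples x (x *: h z) = 0) ?subr0 //.
by apply/pi_multiples_eq0; exists (h z).
Qed.

(** The map p |-> lam(p) s from P to P / cP is multiplication by a scalar r; as it kills c, the
    element rc lies in cP, and r lies in P. *)
Lemma socle_multiplier (s : M) (lam : {linear PP -> k}) :
  socle s -> lam c = 0 ->
  exists r : PP, forall p a, lam p = quotmod_pi m a -> a *: s = pi_multiples x ((submod_val r : R) *: p).
Proof.
move=> sS lamc; have [chi chiE] := socle_map sS.
have [r rE] := lift_to_multiplication (chi \o lam).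
have /pi_multiples_eq0[q qE] : pi_multiples x (r *: c) = 0.
  by rewrite -rE /= lamc linear0.
have rq : r = submod_val q.
  apply/eqP; rewrite -subr_eq0; apply/eqP/creg.
  have := congr1 (@submod_val _ _ P) qE; rewrite !linearZ => rcq.
  by rewrite mulrBr [x * r]mulrC; apply/eqP; rewrite subr_eq0; apply/eqP.
by exists q => p a pa; rewrite -rq -rE /= pa chiE.
Qed.

Variables (n : nat) (coord : 'I_n -> {linear PP -> k}) (i0 : 'I_n) (e0 : PP).
Hypothesis coordP : forall p, (forall i, coord i p = 0) <-> exists r : R, p = r *: c.
Hypothesis coord_e0 : coord i0 e0 = quotmod_pi m (1 : R^o).

Lemma coordc i : coord i c = 0.
Proof. by apply: (coordP c).2; exists 1; rewrite scale1r. Qed.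

(** For s and t in the socle let rs and rt be the elements of P that induce the maps
    p |-> lam_i(p) s and p |-> lam_i0(p) t. The product of rs and rt, read both ways, gives
    lam_i(rt) s = lam_i0(rs) t in P / cP. The element rt is not in Rc, for it takes e0 to
    t <> 0; so lam_i(rt) is a unit for some i. *)
Lemma socle_dim_le1 (s t : M) : socle s -> socle t -> t <> 0 -> exists r : R, s = r *: t.
Proof.
move=> sS tS tN.
have [rt rtE] := socle_multiplier tS (coordc i0).
have [i ci] : exists i, coord i rt <> 0.
  apply: contrapT => nc; apply: tN.
  have [|b bE] := (coordP rt).1.
    by move=> i; apply: contrapT => ci; apply: nc; exists i.
  rewrite -[t]scale1r (rtE _ _ coord_e0) bE; apply/pi_multiples_eq0.
  by exists (b *: e0); rewrite linearZ scalerA mulrC.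
have [rs rsE] := socle_multiplier sS (coordc i).
pose a : R := generic_quotient.repr (coord i rt).
pose b : R := generic_quotient.repr (coord i0 rs).
have ast : a *: s = b *: t.
  rewrite (rsE rt a) ?quotmod_piK // (rtE rs b) ?quotmod_piK //.
  by rewrite ideal_scaleC.
have aN : a \notin m.
  by apply/negP => /residue_eq0; rewrite quotmod_piK.
have [u um] := maximal_ideal_unit m_max aN.
exists (u * b); rewrite -scalerA -ast scalerA.
by rewrite -[s in LHS]scale1r -[1](subrK (u * a)) scalerDl (sS _ um) add0r.
Qed.

Hypothesis m_c : forall (y : R) (p : PP), y \in m -> exists r : R, y *: p = r *: c.

(** By faithfulness some product e0 p is not in cP, and m e0 p lies in c P because m e0 lies in Rc. *)
Lemma socle_nonzero : exists2 s : M, socle s & s <> 0.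
Proof.
have [p ep] : exists p : PP, pi_multiples x ((submod_val e0 : R) *: p) <> 0.
  apply: contrapT => np.
  have [|b bE] := (quotient_faithful (submod_val e0)).1.
    move=> v; have [p <-] := pi_multiples_surj v; rewrite -linearZ.
    by apply: contrapT => ep; apply: np; exists p.
  have : coord i0 e0 = 0.
    apply: (coordP e0).2; exists b; apply: submod_val_inj; rewrite bE linearZ //.
  by rewrite coord_e0 => /residue_eq0; apply/negP; case: m_max.
exists (pi_multiples x ((submod_val e0 : R) *: p)) => // y ym.
rewrite -linearZ ideal_scaleC; apply/pi_multiples_eq0.
have [r rE] := m_c e0 ym.
exists (r *: p); rewrite scalerA mulrC -scalerA rE scalerA mulrC -scalerA.
by rewrite [_ *: c]ideal_scaleC scalerA mulrC -scalerA.
Qed.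

End IdealSocle.

(** * Precanonical ideals with P / (c) a vector space are canonical *)

Theorem theorem1p3 (R : comNzRingType) (m : ideal R)
    (R_CM : cohen_macaulay m 1)
    (R_can : exists K : ideal R, canonical_ideal m 1 K)
    (P : ideal R) (P_primary : primary_to m P) (P_precan : precanonical P)
    (c : submod_type P) (n : nat) (n_gt0 : (0 < n)%N)
    (P_mod_c : isomorphic (quotmod (cyclic_submod c))
                          {ffun 'I_n -> residue_field m}) :
  canonical_ideal m 1 P.
Proof.
have [noethR [m_max _] _ [[[|y [|? ?]] [] //= _ ym yreg] _]] := R_CM.
have [_ rad] := P_primary; have [P_closed P_ext] := P_precan.
have [phi phi_bij] := P_mod_c.
pose x : R := submod_val c.
have pic p : quotmod_pi (cyclic_submod c) p = 0 <-> exists r : R, p = r *: c.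
  rewrite -(linear0 (@quotmod_pi R _ (cyclic_submod c))) quotmod_piP subr0.
  by split=> [/asboolP|h]; last by apply/asboolP.
have /choice[coord coordE] : forall i : 'I_n, exists g : {linear submod_type P -> residue_field m},
    forall p, g p = phi (quotmod_pi (cyclic_submod c) p) i.
  move=> i.
  apply: (@linear_exists R (submod_type P) (residue_field m)
    (fun p => phi (quotmod_pi (cyclic_submod c) p) i)) => a u v.
  by rewrite (linearP (@quotmod_pi R _ _)) (linearP phi) !ffunE.
have coordP p : (forall i, coord i p = 0) <-> exists r : R, p = r *: c.
  rewrite -pic; split=> [p0|p0 i]; last by rewrite coordE p0 linear0 ffunE.
  apply: (bij_inj phi_bij); rewrite linear0; apply/ffunP => i.
  by rewrite -coordE p0 ffunE.
have m_c (z : R) (p : submod_type P) : z \in m -> exists r : R, z *: p = r *: c.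
  by move=> zm; apply/coordP => i; rewrite linearZ /= residue_killed.
pose i0 := Ordinal n_gt0.
have [e0 e0E] : exists e0, coord i0 e0 = quotmod_pi m (1 : R^o).
  have [psi _ psiK] := phi_bij.
  exists (generic_quotient.repr (psi [ffun => quotmod_pi m (1 : R^o)])).
  by rewrite coordE quotmod_piK psiK ffunE.
have m_nil (z : R) : z \in m -> exists N b, z ^+ N = b * x.
  move=> zm; have [N zN] := (rad z).1 zm.
  have [r rE] := m_c z (exist (fun w : R^o => w \in P) _ zN) zm.
  exists N.+1, r; rewrite exprS; exact: (congr1 (@submod_val _ _ P) rE).
have cm : x \in m.
  by apply/(rad x).2; exists 1; rewrite expr1; exact: (valP c).
(* a power of the regular element y lies in Rx *)
have creg r : x * r = 0 -> r = 0.
  have y_reg z : y * z = 0 -> z = 0.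
    case: yreg => /(_ 0 isT z) /= H _ yz0.
    have [|a ->] := H; last by rewrite big_ord0.
    by exists (fun=> 0); rewrite yz0 big_ord0.
  move=> xr; have [N [b yN]] := m_nil y (ym y (mem_head _ _)).
  have : y ^+ N * r = 0 by rewrite yN -mulrA xr mulr0.
  elim: N {yN} => [|N IH]; first by rewrite expr0 mul1r.
  by rewrite exprS -mulrA => /y_reg.
have soc1 := socle_dim_le1 m_max creg P_closed P_ext coordP e0E.
have faithful := quotient_faithful creg P_closed.
have [s0 s0S s0N] := socle_nonzero m_max creg P_closed coordP e0E m_c.
have mS : is_submodule (fun z : R^o => z \in m) by exact: submodClosed_is_submodule.
have Preg := ideal_regular creg.
have Pinj (U T : lmodType R) (iota : {linear U -> T})
    (f : {linear U -> quot_multiples (submod_type P) x}) :=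
  @injective_extension R _ x faithful _ soc1 noethR mS m_nil U T iota f.
have kc (z : residue_field m) : x *: z = 0 by exact: residue_killed.
exists (submod_type P); split; last exact: isomorphic_refl.
split; first exact: noethR.
  case=> [_|[//|i] _]; first exact: (Ext0_zero Preg kc).
  exact: (Ext_higher_zero Preg Pinj creg kc).
apply: (Ext1_residue m_max cm Preg s0S s0N) => s sS.
exact: soc1.
Qed.
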